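(* Let $E: y^2+xy=x^3+x^2-2x$ and $E': y^2+xy=x^3+x^2+8x+10$ be elliptic curves over $\mathbb{Q}$, let $P=(2,2)\in E(\mathbb{Q})$ and $R=(1,4)\in E'(\mathbb{Q})$. Let $(a_m)_{m\ge0}$ be the Somos-5 sequence ($a_0=\dots=a_4=1$, $a_m=(a_{m-1}a_{m-4}+a_{m-2}a_{m-3})/a_{m-5}$ for $m\ge5$). Let $p$ be a prime with $p\notin\{2,3,17\}$. If $p$ divides some term $a_m$, then the order of (the reduction of) $P$ in $E(\mathbb{F}_p)$ is twice the order of (the reduction of) $R$ in $E'(\mathbb{F}_p)$. Otherwise, the order of $P$ in $E(\mathbb{F}_p)$ equals the order of $R$ in $E'(\mathbb{F}_p)$.
   Context: $E$ and $E'$ have good reduction at every prime $p\notin\{2,3,17\}$ ($E$ has conductor $102$). There is a $2$-isogeny $\phi:E\to E'$, $\phi(x,y)=\left(\frac{x^2-2}{x},\frac{x^2y+2x+2y}{x^2}\right)$, with kernel $\{O,(0,0)\}$ and $\phi(P)=R$. *)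

(* Defs.v *)
From HB Require Import structures.
From mathcomp Require Import all_boot all_order all_algebra.
From mathcomp Require Import ring.

Set Implicit Arguments.
Unset Strict Implicit.
Unset Printing Implicit Defensive.

Import Order.TTheory GRing.Theory Num.Theory.
Local Open Scope ring_scope.

(* y^2 + a1 x y + a3 y = x^3 + a2 x^2 + a4 x + a6 *)
Record weierstrass (F : Type) :=
  Weierstrass { wa1 : F; wa2 : F; wa3 : F; wa4 : F; wa6 : F }.

Definition map_weierstrass (F G : Type) (f : F -> G) (C : weierstrass F) :
    weierstrass G :=
  Weierstrass (f (wa1 C)) (f (wa2 C)) (f (wa3 C)) (f (wa4 C)) (f (wa6 C)).

(* [None] is the point at infinity, [Some (x, y)] an affine point. *)
Definition point (F : Type) := option (F * F).

Section GroupLaw.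
Variable F : fieldType.
Implicit Types (C : weierstrass F) (P Q : point F).

Definition discriminant C : F :=
  let b2 := wa1 C ^+ 2 + 4 * wa2 C in
  let b4 := 2 * wa4 C + wa1 C * wa3 C in
  let b6 := wa3 C ^+ 2 + 4 * wa6 C in
  let b8 := wa1 C ^+ 2 * wa6 C + 4 * wa2 C * wa6 C - wa1 C * wa3 C * wa4 C
            + wa2 C * wa3 C ^+ 2 - wa4 C ^+ 2 in
  - b2 ^+ 2 * b8 - 8 * b4 ^+ 3 - 27 * b6 ^+ 2 + 9 * b2 * b4 * b6.

Definition on_curve C P : bool :=
  if P is Some (x, y) then
    y ^+ 2 + wa1 C * x * y + wa3 C * y
      == x ^+ 3 + wa2 C * x ^+ 2 + wa4 C * x + wa6 C
  else true.

(* Chord-tangent addition; only meaningful for two points of [C].  There, when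
   x1 = x2 and the points are not opposite, they are equal and [lam] is the
   slope of the tangent, with nonzero denominator. *)
Definition addp C P Q : point F :=
  match P, Q with
  | None, _ => Q
  | _, None => P
  | Some (x1, y1), Some (x2, y2) =>
    if (x1 == x2) && (y1 + y2 + wa1 C * x1 + wa3 C == 0) then None
    else
      let lam :=
        if x1 == x2
        then (3 * x1 ^+ 2 + 2 * wa2 C * x1 + wa4 C - wa1 C * y1)
               / (2 * y1 + wa1 C * x1 + wa3 C)
        else (y2 - y1) / (x2 - x1) in
      let x3 := lam ^+ 2 + wa1 C * lam - wa2 C - x1 - x2 in
      let y3 := - (lam * (x3 - x1) + y1) - wa1 C * x3 - wa3 C in
      Some (x3, y3)
  end.

Definition mulp C (n : nat) P : point F := iter n (addp C P) None.

(* [P] has finite order [n] in the group of points of [C]. *)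
Definition has_order C P (n : nat) : Prop :=
  [/\ (0 < n)%N, mulp C n P = None &
      forall m : nat, (0 < m < n)%N -> mulp C m P <> None].

Lemma on_curve_addp C P Q :
  on_curve C P -> on_curve C Q -> on_curve C (addp C P Q).
Proof.
case: C => a1 a2 a3 a4 a6.
case: P Q => [[x1 y1]|] // [[x2 y2]|] //= /eqP h1 /eqP h2.
have [E12|N12] /= := eqVneq x1 x2.
  subst x2; case: ifP => //= /negbT Ny; apply/eqP.
  have e12: y2 = y1.
    have : (y2 - y1) * (y1 + y2 + a1 * x1 + a3) = 0.
      rewrite [LHS](_ : _ = (y2 ^+ 2 + a1 * x1 * y2 + a3 * y2)
                          - (y1 ^+ 2 + a1 * x1 * y1 + a3 * y1)); last by ring.
      by rewrite h1 h2 subrr.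
    by move/eqP; rewrite mulf_eq0 (negPf Ny) orbF subr_eq0 => /eqP.
  subst y2.
  have Nd : 2 * y1 + a1 * x1 + a3 != 0 by rewrite mulr_natl mulr2n.
  have e6 : a6 = y1 ^+ 2 + a1 * x1 * y1 + a3 * y1
      - (x1 ^+ 3 + a2 * x1 ^+ 2 + a4 * x1) by rewrite h1; ring.
  by rewrite e6; field.
apply/eqP.
have Nx : x2 - x1 != 0 by rewrite subr_eq0 eq_sym.
have e4 : a4 = ((y2 ^+ 2 + a1 * x2 * y2 + a3 * y2) 
   - (y1 ^+ 2 + a1 * x1 * y1 + a3 * y1)
   - (x2 ^+ 3 + a2 * x2 ^+ 2) + (x1 ^+ 3 + a2 * x1 ^+ 2)) / (x2 - x1).
  by rewrite h1 h2; field.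
have e6 : a6 = y1 ^+ 2 + a1 * x1 * y1 + a3 * y1
      - (x1 ^+ 3 + a2 * x1 ^+ 2 + a4 * x1) by rewrite h1; ring.
by rewrite e6 e4; field.
Qed.

End GroupLaw.

(* Reduction modulo [p]: [ratr q] is numerator over denominator in ['F_p], which
   is the residue of [q] when [p] does not divide the denominator. *)
Definition reduce_curve (p : nat) (C : weierstrass rat) : weierstrass 'F_p :=
  map_weierstrass ratr C.

(* For a curve given by a [p]-integral equation, a point whose coordinates are
   not both [p]-integral reduces to infinity. *)
Definition reduce_point (p : nat) (P : point rat) : point 'F_p :=
  if P is Some (x, y) then
    if (p%:Z %| denq x)%Z || (p%:Z %| denq y)%Z then None
    else Some (ratr x, ratr y)
  else None.

Definition curveE : weierstrass rat := Weierstrass 1 1 0 (- 2) 0.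
Definition curveE' : weierstrass rat := Weierstrass 1 1 0 8 10.
Definition pointP : point rat := Some (2, 2).
Definition pointR : point rat := Some (1, 4).

Lemma discriminant_curveE : discriminant curveE = 2 ^+ 2 * 3 ^+ 2 * 17.
Proof. by apply/eqP. Qed.

Lemma discriminant_curveE' :
  discriminant curveE' = - (2 * 3 ^+ 4 * 17 ^+ 2).
Proof. by apply/eqP. Qed.

Lemma on_curve_pointP : on_curve curveE pointP.
Proof. by []. Qed.

Lemma on_curve_pointR : on_curve curveE' pointR.
Proof. by []. Qed.

Lemma reduce_curveE p : reduce_curve p curveE = Weierstrass 1 1 0 (- 2) 0.
Proof.
by rewrite /reduce_curve /map_weierstrass /= /ratr /= ?divr1 ?mul0r.
Qed.

Lemma reduce_curveE' p : reduce_curve p curveE' = Weierstrass 1 1 0 8 10.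
Proof.
by rewrite /reduce_curve /map_weierstrass /= /ratr /= ?divr1 ?mul0r.
Qed.

Lemma reduce_pointP p : prime p -> reduce_point p pointP = Some (2, 2).
Proof.
move=> pr; rewrite /reduce_point /= dvdz1 /= (gtn_eqF (prime_gt1 pr)) /=.
by rewrite /ratr /= divr1.
Qed.

Lemma reduce_pointR p : prime p -> reduce_point p pointR = Some (1, 4).
Proof.
move=> pr; rewrite /reduce_point /= dvdz1 /= (gtn_eqF (prime_gt1 pr)) /=.
by rewrite /ratr /= !divr1.
Qed.

Fixpoint somos5 (m : nat) : rat :=
  match m with
  | ((((m0.+1 as m1).+1 as m2).+1 as m3).+1 as m4).+1 =>
      (somos5 m4 * somos5 m1 + somos5 m3 * somos5 m2) / somos5 m0
  | _ => 1
  end.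

(* [q] is an integer and [d] divides it in the ring of integers. *)
Definition int_dvd (d : nat) (q : rat) : Prop :=
  exists k : int, q = (k * d%:Z)%:~R.

(* Main.v *)
(* Write O for infinity and T = (0, 0) for the generator of ker phi.  As phi
   commutes with translation by P, the order of R is the least n > 0 with nP in
   {O, T}.  Since - T = T, nP = T is equivalent to T + nP = O, so in that case
   2nP = O and P has order 2n; if nP = O, then T is not a multiple of P.  It
   remains to see that kP = T modulo p iff p divides a_(k+2).  With
   A_k = a_(k+2), the point T + kP has abscissa 2 - c A_(k+1) A_(k-1) / A_k^2,
   c = 2 or 3 by the parity of k, and is O iff p divides A_k: this follows by
   induction on k from the formula for x(Q + P) + x(Q - P) and from a cubic
   relation between five consecutive Somos terms.  That relation also yields
   the integrality of the sequence. *)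
Require Import Defs.
From mathcomp Require Import all_boot all_order all_algebra.
From mathcomp Require Import ring zify.

Set Implicit Arguments.
Unset Strict Implicit.
Unset Printing Implicit Defensive.

Import Order.TTheory GRing.Theory Num.Theory.
Local Open Scope ring_scope.

(** The constant c of the abscissa formula is also the last coefficient of the cubic relation. The
    ring is a parameter because the relation is read in [rat], in [int] and in [F]. *)
Definition somos_coef {S : pzRingType} (n : nat) : S := if odd n then 3 else 2.

(** * Integrality and local coprimality of the Somos-5 terms *)

Section Somos.
Variable s : nat -> rat.
Hypothesis s_init : forall n, (n < 5)%N -> s n = 1.
Hypothesis s_recE : forall n,
  s n.+4.+1 = (s n.+4 * s n.+1 + s n.+3 * s n.+2) / s n.

Lemma somos_gt0 n : 0 < s n.
Proof.
elim/ltn_ind: n => n IH.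
have [n5|n5] := ltnP n 5; first by rewrite s_init.
have -> : n = (n - 5).+4.+1 by lia.
by rewrite s_recE divr_gt0 ?addr_gt0 ?mulr_gt0 //; apply: IH; lia.
Qed.

Lemma somos_neq0 n : s n != 0.
Proof. by rewrite gt_eqF ?somos_gt0. Qed.

Lemma somos_rec n :
  s n.+4.+1 * s n = s n.+4 * s n.+1 + s n.+3 * s n.+2.
Proof. by rewrite s_recE divfK ?somos_neq0. Qed.

(* With f_n = s_n s_(n+3) / (s_(n+1) s_(n+2)) the recurrence is the QRT map
   f_(n+2) f_(n+1) f_n = f_(n+1) + 1; this is the numerator of its invariant
   x y (x + y) + x + y + 1 - 5 x y at x = f_n, y = f_(n+1). *)
Definition somos_quintic n : rat :=
  (s n * s n.+3 ^+ 2 + s n.+1 ^+ 2 * s n.+4) * (s n * s n.+4 + s n.+2 ^+ 2)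
  + s n.+1 * s n.+2 ^+ 3 * s n.+3
  - 5 * s n * s n.+1 * s n.+2 * s n.+3 * s n.+4.

(** It vanishes at the initial values, and passing from n to n+1 multiplies it by s_(n+5) / s_n. *)
Lemma somos_quintic_eq0 n : somos_quintic n = 0.
Proof.
elim: n => [|n IH]; first by rewrite /somos_quintic !s_init.
suff e : somos_quintic n.+1 = somos_quintic n * s n.+4.+1 / s n.
  by rewrite e IH !mul0r.
rewrite /somos_quintic s_recE; field; exact: somos_neq0.
Qed.

(** Let D_n be 5 s_(n+1) s_(n+2) s_(n+3) minus the left side. The quintic relation makes the product
    of D_n / s_(n+2)^3 and D_(n+1) / s_(n+3)^3 equal to 6, so this quotient alternates between its
    initial value 3 and 2. *)
Lemma somos_cubic n :
  s n.+4 * s n.+1 ^+ 2 + s n * s n.+3 ^+ 2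
    = 5 * s n.+1 * s n.+2 * s n.+3 - somos_coef n.+1 * s n.+2 ^+ 3.
Proof.
elim: n => [|n IH]; first by rewrite !s_init // /somos_coef /=; ring.
pose D m := 5 * s m.+1 * s m.+2 * s m.+3
            - (s m.+4 * s m.+1 ^+ 2 + s m * s m.+3 ^+ 2).
have DD : D n * D n.+1 = 6 * s n.+2 ^+ 3 * s n.+3 ^+ 3.
  (* Once the recurrence has eliminated s_(n+5), the difference is a multiple of the quintic, with
     the cofactor shown. *)
  have e : D n * D n.+1 - 6 * s n.+2 ^+ 3 * s n.+3 ^+ 3 =
      (s n.+1 * s n.+4 - 5 * s n.+2 * s n.+3) * somos_quintic n / s n.
    by rewrite /D /somos_quintic s_recE; field; exact: somos_neq0.
  by apply/eqP; rewrite -subr_eq0 e somos_quintic_eq0 mulr0 mul0r.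
have Dn : D n = somos_coef n.+1 * s n.+2 ^+ 3 by rewrite /D IH; ring.
have c6 : somos_coef n.+1 * somos_coef n.+2 = 6 :> rat.
  by rewrite /somos_coef /=; case: odd.
have nz : somos_coef n.+1 * s n.+2 ^+ 3 != 0.
  by rewrite mulf_neq0 ?expf_neq0 ?somos_neq0 // /somos_coef; case: odd.
have e : D n.+1 = somos_coef n.+2 * s n.+3 ^+ 3.
  by apply: (mulfI nz); rewrite -{1}Dn DD -c6; ring.
by rewrite -e /D; ring.
Qed.

Let z n : int := numq (s n).

(** The two claims need a joint induction: coprimality of s_m and s_(m+2) makes s_(m+5) an integer,
    and the recurrence between integers then makes s_(m+5) prime to its four predecessors. *)
Lemma somos_int_coprime n :
  (forall i, (i < n)%N -> s i = (z i)%:~R) /\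
  (forall i j, (i < j < n)%N -> (j < i + 5)%N -> coprimez (z i) (z j)).
Proof.
elim: n => [|n [IHs IHz]]; first by split=> [i|i j]; lia.
have [n5|n5] := ltnP n 5.
  have z1 i : (i < 5)%N -> z i = 1 by move=> i5; rewrite /z s_init.
  split=> [i ni|i j ni _]; first by rewrite z1 ?s_init //; lia.
  by rewrite !z1 ?coprimez1 //; lia.
move: IHs IHz; have -> : n = (n - 5).+4.+1 by lia.
move: (n - 5)%N => m IHs IHz.
have sz : s m.+4.+1 = (z m.+4.+1)%:~R.
  (* [s_(m+5)] times [s_m] and times [s_(m+2)^2] are integers, by the
     recurrence and the cubic relation; the two factors are coprime. *)
  have cz : coprimez (z m) (z m.+2 ^+ 2) by rewrite coprimezXr // IHz; lia.
  have [[u v] /= uv] := coprimezP _ _ cz.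
  have int_s i : (i < m.+4.+1)%N -> s i \is a Num.int.
    by move=> im; rewrite IHs ?intr_int.
  have e : s m.+4.+1 =
      u%:~R * (s m.+4 * s m.+1 + s m.+3 * s m.+2)
      + v%:~R * (5 * s m.+2 * s m.+3 * s m.+4 - somos_coef m.+2 * s m.+3 ^+ 3
                 - s m.+1 * s m.+4 ^+ 2).
    have -> : s m.+4.+1 = (u * z m + v * z m.+2 ^+ 2)%:~R * s m.+4.+1.
      by rewrite uv mul1r.
    have := somos_cubic m.+1 => /(canRL (addrK _)) h.
    rewrite -h -somos_rec rmorphD !rmorphM /= -!IHs; [ring | lia | lia].
  have int_coef : somos_coef m.+2 \is a @Num.int rat.
    by rewrite /somos_coef; case: odd.
  rewrite /z numqK // e.
  have int5 : 5 \is a @Num.int rat by [].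
  move: (somos_coef m.+2) (5 : rat) int_coef int5 => c5 cc int_c5 int_cc.
  by rewrite !(rpredB, rpredD, rpredM, rpredX, intr_int) ?int_s //; lia.
have rz : z m.+3 * z m.+2 = z m.+4.+1 * z m - z m.+4 * z m.+1.
  apply: (@intr_inj rat); rewrite rmorphB !rmorphM /= -sz -!IHs; try lia.
  by rewrite somos_rec; ring.
split.
  move=> i; rewrite ltnS leq_eqVlt => /orP[/eqP ->//|]; exact: IHs.
move=> i j /andP[ij]; rewrite ltnS leq_eqVlt.
move=> /orP[/eqP ej j5|jm j5]; last first.
  by apply: IHz; lia.
subst j.
have cop i1 i2 : (m <= i1 < m + 5)%N -> (m <= i2 < m + 5)%N -> i1 != i2 ->
    coprimez (z i1) (z i2).
  move=> h1 h2 ne; have [lt12|le21] := ltnP i1 i2; first by apply: IHz; lia.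
  by rewrite coprimez_sym; apply: IHz; lia.
(* Modulo z_k, the recurrence equates z_(m+5) z_m, up to sign, with a product r of two older terms
   other than z_k, and r is prime to z_k. *)
have cop_new k q r : coprimez (z k) r ->
    r = q * z k + z m.+4.+1 * z m -> coprimez (z k) (z m.+4.+1).
  move=> ckr er; move: ckr.
  by rewrite er /coprimez gcdzMDl -/(coprimez _ _) coprimezMr => /andP[].
have : (i \in [:: m.+1; m.+2; m.+3; m.+4])%N by rewrite !inE; lia.
rewrite !inE => /or4P[]/eqP->.
- apply: (cop_new _ (- z m.+4) (z m.+3 * z m.+2)); last by rewrite rz; ring.
  by rewrite coprimezMr !cop; lia.
- apply: (cop_new _ (- z m.+3) (z m.+4 * z m.+1)).
    by rewrite coprimezMr !cop; lia.
  by apply: (addIr (z m.+3 * z m.+2)); rewrite {1}rz; ring.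
- apply: (cop_new _ (- z m.+2) (z m.+4 * z m.+1)).
    by rewrite coprimezMr !cop; lia.
  by apply: (addIr (z m.+3 * z m.+2)); rewrite {1}rz; ring.
- apply: (cop_new _ (- z m.+1) (z m.+3 * z m.+2)); last by rewrite rz; ring.
  by rewrite coprimezMr !cop; lia.
Qed.

Lemma somos_int n : s n = (z n)%:~R.
Proof. by have [h _] := somos_int_coprime n.+1; apply: h. Qed.

Lemma somos_coprime i j : (i < j < i + 5)%N -> coprimez (z i) (z j).
Proof.
move=> /andP[ij j5]; have [_ h] := somos_int_coprime j.+1.
by apply: h; rewrite ?ij /=.
Qed.

Lemma somos_int_rec n :
  z n.+4.+1 * z n = z n.+4 * z n.+1 + z n.+3 * z n.+2.
Proof.
by apply: (@intr_inj rat); rewrite rmorphD !rmorphM /= -!somos_int somos_rec.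
Qed.

Lemma somos_int_cubic n :
  z n.+4 * z n.+1 ^+ 2 + z n * z n.+3 ^+ 2
    = 5 * z n.+1 * z n.+2 * z n.+3 - somos_coef n.+1 * z n.+2 ^+ 3.
Proof.
apply: (@intr_inj rat); rewrite rmorphB rmorphD !rmorphM /= -!somos_int.
rewrite (_ : (somos_coef n.+1)%:~R = somos_coef n.+1); last first.
  by rewrite /somos_coef; case: odd.
have := somos_cubic n; rewrite !exprS !expr0 !mulr1 => ->; ring.
Qed.

End Somos.

(** * Chord and tangent sums with a prescribed slope *)

Section Secants.
Variables (F : fieldType) (C : weierstrass F).

(** [l] is the slope of the chord or tangent. As an argument it can be a free parameter or a
    simplified expression, certified by an equation in product form. *)
Definition secant_sum (l x1 y1 x2 : F) : point F :=
  let x3 := l ^+ 2 + wa1 C * l - wa2 C - x1 - x2 in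
  Some (x3, - (l * (x3 - x1) + y1) - wa1 C * x3 - wa3 C).

Lemma addp_chord l x1 y1 x2 y2 :
  x1 != x2 -> y2 - y1 = l * (x2 - x1) ->
  addp C (Some (x1, y1)) (Some (x2, y2)) = secant_sum l x1 y1 x2.
Proof.
move=> ne e; have nz : x2 - x1 != 0 by rewrite subr_eq0 eq_sym.
by rewrite /addp /secant_sum (negPf ne) /= e mulfK.
Qed.

Lemma addp_tangent l x1 y1 :
  2 * y1 + wa1 C * x1 + wa3 C != 0 ->
  3 * x1 ^+ 2 + 2 * wa2 C * x1 + wa4 C - wa1 C * y1
    = l * (2 * y1 + wa1 C * x1 + wa3 C) ->
  addp C (Some (x1, y1)) (Some (x1, y1)) = secant_sum l x1 y1 x1.
Proof.
move=> nz e; rewrite /addp /secant_sum eqxx /=.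
rewrite [y1 + y1](_ : _ = 2 * y1); last by ring.
by rewrite (negPf nz) e mulfK.
Qed.

Lemma addp_opposite x1 y1 y2 :
  y1 + y2 + wa1 C * x1 + wa3 C = 0 ->
  addp C (Some (x1, y1)) (Some (x1, y2)) = None.
Proof. by move=> e; rewrite /addp eqxx e eqxx. Qed.

End Secants.

Arguments addp : simpl never.

(** * Translation by P on E, and the isogeny to E' *)

Section Isogeny.
Variable F : fieldType.
Hypotheses (two_neq0 : 2 != 0 :> F) (three_neq0 : 3 != 0 :> F).

Let E : weierstrass F := Weierstrass 1 1 0 (- 2) 0.
Let E' : weierstrass F := Weierstrass 1 1 0 8 10.
Let P : point F := Some (2, 2).
Let NP : point F := Some (2, - 4).
Let T : point F := Some (0, 0).
Let R : point F := Some (1, 4).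

Definition oppE (Q : point F) : point F :=
  if Q is Some (x, y) then Some (x, - y - x) else None.

(** On the curve, [x == 0] singles out T, so exactly the two kernel points are sent to infinity. *)
Definition isog (Q : point F) : point F :=
  if Q is Some (x, y) then
    if x == 0 then None
    else Some ((x ^+ 2 - 2) / x,
               (x ^+ 2 * y + 2 * x + 2 * y) / x ^+ 2)
  else None.

Let two_neq1 : 2 != 1 :> F.
Proof. by rewrite -subr_eq0 [_ - _](_ : _ = 1) ?oner_neq0 //; ring. Qed.

Let four_neq0 : 4 != 0 :> F.
Proof. by rewrite [4](_ : _ = 2 * 2) ?mulf_neq0 //; ring. Qed.

Let six_neq0 : 6 != 0 :> F.
Proof. by rewrite [6](_ : _ = 2 * 3) ?mulf_neq0 //; ring. Qed.

Let nine_neq0 : 9 != 0 :> F.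
Proof. by rewrite [9](_ : _ = 3 * 3) ?mulf_neq0 //; ring. Qed.

(** Solved for y^2, the curve equation serves as the side relation given to [ring] and [field]. *)
Let onE x y : on_curve E (Some (x, y)) ->
  y ^+ 2 = x ^+ 3 + x ^+ 2 - 2 * x - x * y.
Proof.
move=> /eqP /= h; apply: (addIr (1 * x * y + 0 * y)); rewrite !addrA h; ring.
Qed.

Let onE2 y : on_curve E (Some (2, y)) -> y = 2 \/ y = - 4.
Proof.
move=> /onE h; have /eqP : (y - 2) * (y + 4) = 0 by ring: h.
by rewrite mulf_eq0 subr_eq0 addr_eq0 => /orP[] /eqP; [left | right].
Qed.

Let onE0 y : on_curve E (Some (0, y)) -> y = 0.
Proof.
move=> /onE h; have /eqP : y ^+ 2 = 0 by rewrite h; ring.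
by rewrite expf_eq0 => /eqP.
Qed.

(** These points are P + T and its opposite. The isogeny maps them to R and -R, where the chord from
    R on E' degenerates. *)
Let onEm1 y : on_curve E (Some (-1, y)) -> y = 2 \/ y = - 1.
Proof.
move=> /onE h; have /eqP : (y - 2) * (y + 1) = 0 by ring: h.
by rewrite mulf_eq0 subr_eq0 addr_eq0 => /orP[] /eqP; [left | right].
Qed.

Lemma doubleP : addp E P P = Some (1, - 1).
Proof.
rewrite (@addp_tangent _ _ 2) /=; last by ring.
  by rewrite /secant_sum /=; congr (Some (_, _)); ring.
by rewrite [X in X != _](_ : _ = 6) //; ring.
Qed.

Lemma addPN : addp E P NP = None.
Proof. by apply: addp_opposite => /=; ring. Qed.

Lemma addNP : addp E NP P = None.
Proof. by apply: addp_opposite => /=; ring. Qed.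

Lemma addPT : addp E P T = Some (-1, 2).
Proof.
rewrite (@addp_chord _ _ 1) //=; last by ring.
by rewrite /secant_sum /=; congr (Some (_, _)); ring.
Qed.

(** Placing the second point on the line of slope [l] through P makes the sum polynomial in [l] and
    [x]. *)
Lemma addP_chord l x : x != 2 ->
  addp E P (Some (x, 2 + l * (x - 2))) =
  Some (l ^+ 2 + l - 3 - x,
        - (l * (l ^+ 2 + l - 5 - x) + 2) - (l ^+ 2 + l - 3 - x)).
Proof.
move=> ne; rewrite (@addp_chord _ _ l) //=; last by ring.
  by rewrite /secant_sum /=; congr (Some (_, _)); ring.
by rewrite eq_sym.
Qed.

Lemma addN_chord l x : x != 2 ->
  addp E NP (Some (x, - 4 + l * (x - 2))) =
  Some (l ^+ 2 + l - 3 - x,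
        - (l * (l ^+ 2 + l - 5 - x) - 4) - (l ^+ 2 + l - 3 - x)).
Proof.
move=> ne; rewrite (@addp_chord _ _ l) //=; last by ring.
  by rewrite /secant_sum /=; congr (Some (_, _)); ring.
by rewrite eq_sym.
Qed.

Let slopeE (y0 x y : F) : x != 2 -> exists l, y = y0 + l * (x - 2).
Proof.
move=> ne; have nz : x - 2 != 0 by rewrite subr_eq0.
by exists ((y - y0) / (x - 2)); rewrite divfK // addrC subrK.
Qed.

Lemma oppEK : involutive oppE.
Proof. by case=> [[x y]|] //=; congr (Some (_, _)); ring. Qed.

Lemma oppE_addP Q : on_curve E Q -> oppE (addp E P Q) = addp E NP (oppE Q).
Proof.
case: Q => [[x y]|]; last first.
  by move=> _; rewrite /addp /=; congr (Some (_, _)); ring.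
have [->|ne] := eqVneq x 2.
  case/onE2 => ->; last first.
    rewrite addPN /= [- - 4 - 2](_ : _ = 2) ?addNP //; ring.
  rewrite doubleP /= [- 2 - 2](_ : _ = - 4); last by ring.
  rewrite (@addp_tangent _ _ (- 3)) /=; last by ring.
    by rewrite /secant_sum /=; congr (Some (_, _)); ring.
  by rewrite [X in X != _](_ : _ = - 6) ?oppr_eq0 //; ring.
have [l ->] := slopeE 2 y ne => _.
rewrite addP_chord //=.
(* The negation (x, y) -> (x, -y - x) turns a line of slope l into one of slope -l - 1. *)
rewrite [- _ - x](_ : _ = - 4 + (- l - 1) * (x - 2)) ?addN_chord //;
  last by ring.
by congr (Some (_, _)); ring.
Qed.

(** The line through P and Q contains -(P + Q). Its reflection contains -P, P + Q and -Q, hence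
    leads back to Q. *)
Lemma addPK Q : on_curve E Q -> addp E NP (addp E P Q) = Q.
Proof.
case: Q => [[x y]|]; last by move=> _; exact: addNP.
have [->|ne] := eqVneq x 2.
  case/onE2 => ->; last by rewrite addPN.
  rewrite doubleP [- 1](_ : _ = - 4 + - 3 * (1 - 2)); last by ring.
  by rewrite addN_chord 1?eq_sym //; congr (Some (_, _)); ring.
have [l ->] := slopeE 2 y ne => /onE h.
have nz : x - 2 != 0 by rewrite subr_eq0.
rewrite addP_chord //.
have [e|ne3] := eqVneq (l ^+ 2 + l - 3 - x) 2; last first.
  rewrite [X in Some (_, X)](_ : _ = - 4 + (- l - 1) * (l ^+ 2 + l - 3 - x - 2));
    last by ring.
  by rewrite addN_chord //; congr (Some (_, _)); ring.
have ex : x = l ^+ 2 + l - 5.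
  by transitivity (l ^+ 2 + l - 3 - 2); [rewrite -[X in _ - X]e|]; ring.
(* When P + Q has abscissa 2, the curve equation forces l = 2, the slope of the tangent at P: then Q
   = -2P and P + Q = -P. *)
have : 6 * (x - 2) * (l - 2) = 0.
  rewrite ex in h *.
  rewrite [LHS](_ : _ = (2 + l * (l ^+ 2 + l - 5 - 2)) ^+ 2
    - ((l ^+ 2 + l - 5) ^+ 3 + (l ^+ 2 + l - 5) ^+ 2 - 2 * (l ^+ 2 + l - 5) -
      (l ^+ 2 + l - 5) * (2 + l * (l ^+ 2 + l - 5 - 2)))); last by ring.
  by rewrite h subrr.
move/eqP; rewrite !mulf_eq0 (negPf six_neq0) (negPf nz) subr_eq0 => /eqP el.
rewrite ex el (_ : - _ - _ = - 4); last by ring.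
rewrite [_ - 3 - _](_ : _ = 2); last by ring.
rewrite (@addp_tangent _ _ (- 3)) /=; last by ring.
  by rewrite /secant_sum /=; congr (Some (_, _)); ring.
by rewrite [X in X != _](_ : _ = - 6) ?oppr_eq0 //; ring.
Qed.

Lemma addP_inj : {in on_curve E &, injective (addp E P)}.
Proof. by move=> Q1 Q2 h1 h2 e; rewrite -[Q1]addPK // e addPK. Qed.

(** This is [addPK] conjugated by negation. *)
Lemma addNK Q : on_curve E Q -> addp E P (addp E NP Q) = Q.
Proof.
move=> h; have h' : on_curve E (oppE Q).
  case: Q h => [[x y]|] //= /eqP h; apply/eqP; rewrite -h; ring.
apply: (can_inj oppEK); rewrite oppE_addP.
  by rewrite -[Q in LHS]oppEK -(oppE_addP h') oppEK addPK.
by apply: on_curve_addp => //=; apply/eqP; ring.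
Qed.

Let on_P : on_curve E P. Proof. by apply/eqP => /=; ring. Qed.
Let on_NP : on_curve E NP. Proof. by apply/eqP => /=; ring. Qed.
Let on_T : on_curve E T. Proof. by apply/eqP => /=; ring. Qed.

(** An explicit computation, once the points with degenerate chords or images are set apart:
    infinity, and abscissas 2 (P and -P), 0 (T) and -1 (sent to R and -R). *)
Lemma isog_addP Q : on_curve E Q ->
  isog (addp E P Q) = addp E' R (isog Q).
Proof.
have addRN : addp E' R (Some (1, - 5)) = None.
  by apply: addp_opposite => /=; ring.
have doubleR : addp E' R R = Some (-1, -1).
  rewrite (@addp_tangent _ _ 1) /=; last by ring.
    by rewrite /secant_sum /=; congr (Some (_, _)); ring.
  by rewrite [X in X != _](_ : _ = 9) //; ring.
have m1_neq0 : - 1 != 0 :> F by rewrite oppr_eq0 oner_neq0.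
have isogP : isog P = R.
  by rewrite /isog /= (negPf two_neq0); congr (Some (_, _)); field.
have isogNP : isog NP = Some (1, - 5).
  by rewrite /isog /= (negPf two_neq0); congr (Some (_, _)); field.
case: Q => [[x y]|]; last by move=> _; exact: isogP.
have [->|ne2] := eqVneq x 2.
  case/onE2 => ->.
    rewrite doubleP isogP doubleR /isog (negPf (oner_neq0 F)).
    by congr (Some (_, _)); field; rewrite ?oner_neq0.
  by rewrite addPN isogNP addRN.
have [->|ne0] := eqVneq x 0.
  move/onE0 => ->; rewrite addPT /isog eqxx (negPf m1_neq0).
  by rewrite /addp; congr (Some (_, _)); field; rewrite ?oner_neq0.
have [->|nem1] := eqVneq x (-1).
  have isog_m1 y1 : isog (Some (-1, y1)) = Some (1, 3 * y1 - 2).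
    rewrite /isog (negPf m1_neq0).
    by congr (Some (_, _)); field; rewrite ?oner_neq0.
  have ne : -1 != 2 :> F.
    by rewrite -subr_eq0 [_ - _](_ : _ = - 3) ?oppr_eq0 //; ring.
  case/onEm1 => ->; rewrite isog_m1.
    have -> : addp E P (Some (-1, 2)) = Some (- 2, 0).
      transitivity (addp E P (Some (-1, 2 + 0 * (-1 - 2)))).
        by congr (addp _ _ (Some (_, _))); ring.
      by rewrite addP_chord //; congr (Some (_, _)); ring.
    rewrite [3 * 2 - 2](_ : _ = 4) ?doubleR; last by ring.
    rewrite /isog oppr_eq0 (negPf two_neq0).
    by congr (Some (_, _)); field; rewrite ?oppr_eq0.
  have -> : addp E P (Some (-1, -1)) = T.
    transitivity (addp E P (Some (-1, 2 + 1 * (-1 - 2)))).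
      by congr (addp _ _ (Some (_, _))); ring.
    by rewrite addP_chord //; congr (Some (_, _)); ring.
  have -> : 3 * -1 - 2 = - 5 :> F by ring.
  by rewrite addRN /T /isog eqxx.
move=> /onE h.
have nz2 : x - 2 != 0 by rewrite subr_eq0.
have nz1 : x + 1 != 0 by rewrite addr_eq0.
pose N := 2 * x ^+ 2 + 4 * x - 6 * y - 4.
have nzN : N != 0.
  (* [N] is the numerator of the abscissa of P + Q. The second factor is its value at -Q, so the
     product no longer contains y. *)
  have : N * (2 * x ^+ 2 + 10 * x - 4 + 6 * y) = (2 * (x + 1) * (x - 2)) ^+ 2.
    by rewrite /N; ring: h.
  by apply: contra_eqN => /eqP ->; rewrite mul0r eq_sym expf_eq0 /= !mulf_neq0.
pose x3 := N / (x - 2) ^+ 2.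
pose y3 := - ((y - 2) / (x - 2) * (x3 - 2) + 2) - x3.
have -> : addp E P (Some (x, y)) = Some (x3, y3).
  rewrite (@addp_chord _ _ ((y - 2) / (x - 2))) ?divfK //; last by rewrite eq_sym.
  have e : (y - 2) ^+ 2 + (y - 2) * (x - 2) = N + (x + 3) * (x - 2) ^+ 2.
    by rewrite /N; ring: h.
  have e3 : ((y - 2) / (x - 2)) ^+ 2 + (y - 2) / (x - 2) - 1 - 2 - x = x3.
    rewrite /x3; apply: (mulIf (expf_neq0 2 nz2)); rewrite mulfVK ?expf_neq0 //.
    rewrite [RHS](_ : _ = (y - 2) ^+ 2 + (y - 2) * (x - 2) - (x + 3) * (x - 2) ^+ 2).
      by field.
    by rewrite e addrK.
  by rewrite /secant_sum /= !mul1r e3 subr0.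
have nz3 : x3 != 0 by rewrite mulf_neq0 ?invr_eq0 ?expf_neq0.
(* [M] is the numerator of the slope of the chord from R to the image of Q. *)
pose M := x ^+ 2 * y + 2 * x + 2 * y - 4 * x ^+ 2.
rewrite /isog (negPf nz3) (negPf ne0).
rewrite (@addp_chord _ _ (M / (x * (x - 2) * (x + 1)))); last 2 first.
- rewrite eq_sym -subr_eq0 [_ - _](_ : _ = (x - 2) * (x + 1) / x); last by field.
  by rewrite !mulf_neq0 ?invr_eq0.
- by rewrite /M; field; rewrite ne0 nz1 nz2.
rewrite /secant_sum /=; congr (Some (_, _)); rewrite /y3 /x3 /M /N; field: h.
  by rewrite ne0 nz1 nz2 nzN.
by rewrite ne0 nz1 nz2 nzN.
Qed.

(** The sum is unchanged when Q is replaced by -Q, hence free of y. It gives a recurrence of order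
    two for the abscissas of Q + kP. *)
Lemma abscissa_sum x y : on_curve E (Some (x, y)) -> x != 2 ->
  exists x1 y1 x0 y0,
    [/\ addp E P (Some (x, y)) = Some (x1, y1),
        addp E NP (Some (x, y)) = Some (x0, y0) &
        (x1 + x0) * (x - 2) ^+ 2 = 4 * x ^+ 2 + 14 * x - 8].
Proof.
move=> /onE h ne; have nz : x - 2 != 0 by rewrite subr_eq0.
have [l el] := slopeE 2 y ne; have [m em] := slopeE (- 4) y ne.
exists (l ^+ 2 + l - 3 - x),
  (- (l * (l ^+ 2 + l - 5 - x) + 2) - (l ^+ 2 + l - 3 - x)).
exists (m ^+ 2 + m - 3 - x),
  (- (m * (m ^+ 2 + m - 5 - x) - 4) - (m ^+ 2 + m - 3 - x)).
split; first by rewrite el addP_chord.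
  by rewrite em addN_chord.
have -> : l = (y - 2) / (x - 2) by rewrite el addrC addKr mulfK.
have -> : m = (y + 4) / (x - 2) by rewrite em addrAC addNr add0r mulfK.
by field: h.
Qed.

(** * Abscissas of T + kP and Somos terms *)

Section Linking.
(** Stands for the Somos terms modulo p. They may vanish, so the relations proved above by division,
    and the coprimality of near terms, become hypotheses. *)
Variable A : nat -> F.

Hypothesis A_init : forall n, (n < 5)%N -> A n = 1.
Hypothesis A_rec : forall n,
  A n.+4.+1 * A n = A n.+4 * A n.+1 + A n.+3 * A n.+2.
Hypothesis A_inv : forall n,
  A n.+4 * A n.+1 ^+ 2 + A n * A n.+3 ^+ 2
    = 5 * A n.+1 * A n.+2 * A n.+3 - somos_coef n.+1 * A n.+2 ^+ 3.
Hypothesis A_window : forall n i, (0 < i < 5)%N -> A n = 0 -> A (i + n)%N != 0.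

Let coefM n : somos_coef n * somos_coef n.+1 = 6 :> F.
Proof. by rewrite /somos_coef /=; case: odd => /=; ring. Qed.

Let coef_neq0 n : somos_coef n != 0 :> F.
Proof. by rewrite /somos_coef; case: odd. Qed.

(* [Q] has the abscissa which the sequence predicts for T + kP; the index is
   shifted by 2 because the Somos sequence is symmetric about its index 2. *)
Definition linked (Q : point F) (k : nat) : Prop :=
  if Q is Some (x, _) then
    A k.+2 != 0 /\ (x - 2) * A k.+2 ^+ 2 = - (somos_coef k * A k.+3 * A k.+1)
  else A k.+2 = 0.

(** Generically [abscissa_sum] determines the next abscissa from two consecutive ones. The
    degenerate cases are those where Q, P + Q or 2P + Q is infinite. *)
Lemma linked_step Q k : on_curve E Q ->
  linked Q k -> linked (addp E P Q) k.+1 ->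
  linked (addp E P (addp E P Q)) k.+2.
Proof.
move=> onQ lQ lPQ.
have onPQ : on_curve E (addp E P Q) by apply: on_curve_addp.
have wd := A_window (n := k.+2) (i := 2).
have wc := A_window (n := k.+3) (i := 1).
have := A_inv k.+1; have := A_inv k.+2; have := A_rec k.+2.
have c01 := coefM k; have c0n := coef_neq0 k; have c1n := coef_neq0 k.+1.
have c2 : somos_coef k.+2 = somos_coef k :> F by rewrite /somos_coef /= negbK.
have c3 : somos_coef k.+3 = somos_coef k.+1 :> F by rewrite /somos_coef /= !negbK.
move: lQ lPQ wd wc; rewrite /linked c2 c3 !addSn !add0n.
move: (A k.+1) (A k.+2) (A k.+3) (A k.+4) (A k.+4.+1) (A k.+4.+2) (A k.+4.+3).
move: (somos_coef k) (somos_coef k.+1) c01 c0n c1n.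
(* The letters [a] to [g] are A_(k+1) to A_(k+7). [S] is the recurrence g b = f c + e d; [I1] and
   [I2] are the cubic relations centred at [c] and [d]. *)
move=> c0 c1 c01 c0n c1n a b c d e f g lQ lPQ wd wc S I2 I1.
case ePQ : (addp E P Q) lPQ onPQ => [[x y]|]; last first.
  move=> zc _; subst c; split; first exact: wc.
  by ring.
move=> [cn Ec] onPQ.
have [ex|ne] := eqVneq x 2.
  subst x; case: (onE2 onPQ) => ey; subst y; last first.
    rewrite addPN.
    (* Here P + Q = -P, so d = 0 is required. The alternative b = 0 would mean Q = O, hence P + Q =
       P. *)
    have /eqP : c1 * (d * b) = 0 by apply: oppr_inj; rewrite mulrA -Ec; ring.
    rewrite !mulf_eq0 (negPf c1n) /= => /orP[/eqP //|/eqP zb].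
    case: Q lQ onQ ePQ => [[x y]|] /=; first by rewrite zb => -[/eqP].
    rewrite /addp /P => _ _ -[] /eqP.
    rewrite -subr_eq0 [_ - _](_ : _ = 6) ?(negPf six_neq0) //.
    by ring.
  (* Here b = 0, and the recurrence two steps later, g b = f c + e d, is needed
     to eliminate f from the next cubic relation. *)
  rewrite doubleP.
  have eQ : Q = None by apply: addP_inj.
  subst Q; rewrite lQ in S I1 I2 wd; split; first exact: wd.
  apply: (mulfI c1n).
  apply/eqP; rewrite -subr_eq0.
  have /eqP : d * (c1 * d ^+ 2 - 6 * c * e) = 0.
    have fc : f * c = - (e * d) by apply: (addIr (e * d)); rewrite -S; ring.
    have : (f * c) * c + 0 * e ^+ 2 = 5 * c * d * e - c1 * d ^+ 3.
      by rewrite -I2; ring.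
    rewrite fc => h.
    rewrite [LHS](_ : _ = 5 * c * d * e - (5 * c * d * e - c1 * d ^+ 3)
      - 6 * c * d * e); last by ring.
    by rewrite -h; ring.
  rewrite mulf_eq0 (negPf (wd _ _)) //= => /eqP h; apply/eqP.
  rewrite [LHS](_ : _ = - (c1 * d ^+ 2 - c0 * c1 * c * e)); last by ring.
  by rewrite c01 h oppr0.
have [x1 [y1 [x0 [y0 [e1 e0 es]]]]] := abscissa_sum onPQ ne.
have nz : x - 2 != 0 by rewrite subr_eq0.
(* All denominators are now nonzero: x different from 2 forces b and d to be so, and [I1] can be
   solved for e. *)
have : (x - 2) * c ^+ 2 != 0 by rewrite mulf_neq0 ?expf_neq0.
rewrite Ec oppr_eq0 !mulf_eq0 !negb_or => /andP[/andP[_ dn] bn].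
have eQ : Q = Some (x0, y0) by rewrite -e0 -ePQ addPK.
subst Q; case: lQ => _ Eb; rewrite e1; split=> //.
have hx : x = 2 - c1 * d * b / c ^+ 2.
  by apply: (addIr (- 2)); apply: (mulIf (expf_neq0 2 cn)); rewrite Ec; field.
have hx0 : x0 = 2 - c0 * c * a / b ^+ 2.
  by apply: (addIr (- 2)); apply: (mulIf (expf_neq0 2 bn)); rewrite Eb; field.
have hx1 : x1 = (4 * x ^+ 2 + 14 * x - 8) / (x - 2) ^+ 2 - x0.
  by rewrite -es mulfK ?addrK // expf_neq0.
have hx2 : x - 2 = - (c1 * d * b / c ^+ 2) by rewrite hx; ring.
have h1 : c1 = 6 / c0 by rewrite -c01 mulrC mulKf.
have he : e = (5 * b * c * d - c0 * c ^+ 3 - a * d ^+ 2) / b ^+ 2.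
  by rewrite -I1; field.
rewrite hx1 hx2 hx0 hx h1 he; field.
by rewrite bn cn c0n oppr_eq0 !mulf_neq0.
Qed.

Lemma on_iter Q0 Q k :
  on_curve E Q0 -> on_curve E Q -> on_curve E (iter k (addp E Q0) Q).
Proof. by move=> h0 hQ; elim: k => //= k; apply: on_curve_addp. Qed.

Lemma linked_iter k : linked (iter k (addp E P) T) k.
Proof.
(* The recurrence has order two, so two consecutive indices are carried along. *)
suff [] : linked (iter k (addp E P) T) k /\
          linked (iter k.+1 (addp E P) T) k.+1 by [].
elim: k => [|k [IH1 IH2]]; last first.
  by split=> //; apply: linked_step => //; apply: on_iter.
rewrite /= addPT /linked !A_init // /somos_coef /=.
by split; split; rewrite ?oner_neq0 //; ring.
Qed.

Lemma iter_addP_T_None k : iter k (addp E P) T = None <-> A k.+2 = 0.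
Proof.
by have := linked_iter k; case: (iter k _ T) => [[x y] [/eqP h _]|] //= ->.
Qed.

End Linking.

(** * Multiples of P and of R, and the kernel of the isogeny *)

Lemma iter_addP_opp k Q : on_curve E Q ->
  oppE (iter k (addp E P) Q) = iter k (addp E NP) (oppE Q).
Proof.
move=> onQ; elim: k => //= k <-; rewrite oppE_addP //; exact: on_iter.
Qed.

(** As -T = T, the opposite of T + kP is T - kP, which is O when kP = T. Conversely T - kP = O gives
    T = kP on translating back k times. *)
Lemma iter_addP_None k :
  iter k (addp E P) None = T <-> iter k (addp E P) T = None.
Proof.
have oT : oppE T = T by rewrite /T /= oppr0 addr0.
have iterK Q1 Q2 Q : on_curve E Q1 -> on_curve E Q ->
    (forall Q', on_curve E Q' -> addp E Q2 (addp E Q1 Q') = Q') ->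
    iter k (addp E Q2) (iter k (addp E Q1) Q) = Q.
  move=> on1 onQ K; elim: k => // j IH.
  by rewrite iterS [X in iter _ _ X]iterS -iterS iterSr K ?IH //;
    apply: on_iter.
split=> e.
  by apply: (can_inj oppEK); rewrite iter_addP_opp // oT -e
    iterK //; apply: addPK.
have e' : iter k (addp E NP) T = None by rewrite -{1}oT -iter_addP_opp // e.
by rewrite -e' iterK //; apply: addNK.
Qed.

Lemma isog_iter k : isog (iter k (addp E P) None) = iter k (addp E' R) None.
Proof. by elim: k => //= k <-; rewrite isog_addP //; apply: on_iter. Qed.

Lemma isog_eq_None Q : on_curve E Q -> isog Q = None <-> Q = None \/ Q = T.
Proof.
case: Q => [[x y]|] onQ; last by split=> // _; left.
rewrite /isog /=; case: eqP => [ex|nx]; last by split=> // -[//|[]].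
by subst x; rewrite (onE0 onQ); split=> // _; right.
Qed.

End Isogeny.

(** * Comparison of the two orders over a finite field *)

Lemma order_dichotomy (F : finFieldType) (p : nat) :
  p \in [pchar F] -> 2 != 0 :> F -> 3 != 0 :> F ->
  let hasE :=
    has_order (Weierstrass 1 1 0 (- 2) 0 : weierstrass F) (Some (2, 2)) in
  let hasE' :=
    has_order (Weierstrass 1 1 0 8 10 : weierstrass F) (Some (1, 4)) in
  ((exists m : nat, int_dvd p (somos5 m)) ->
     exists n : nat, hasE' n /\ hasE (2 * n)%N) /\
  (~ (exists m : nat, int_dvd p (somos5 m)) ->
     exists n : nat, hasE' n /\ hasE n).
Proof.
move=> pF n2 n3; rewrite /=.
set E' := Weierstrass 1 1 0 8 10; set E := Weierstrass 1 1 0 (- 2) 0.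
set P := Some (2, 2); set R := Some (1, 4).
pose T : point F := Some (0, 0).
have s_init n : (n < 5)%N -> somos5 n = 1 by case: n => [|[|[|[|[|]]]]].
have s_rec n : somos5 n.+4.+1 =
  (somos5 n.+4 * somos5 n.+1 + somos5 n.+3 * somos5 n.+2) / somos5 n by [].
(* By integrality the numerator is the term itself. *)
pose A n : F := (numq (somos5 n))%:~R.
have A_init n : (n < 5)%N -> A n = 1 by move=> n5; rewrite /A s_init.
have A_rec n : A n.+4.+1 * A n = A n.+4 * A n.+1 + A n.+3 * A n.+2.
  rewrite /A -!rmorphM -rmorphD; congr (_%:~R); exact: somos_int_rec.
have A_inv n : A n.+4 * A n.+1 ^+ 2 + A n * A n.+3 ^+ 2
    = 5 * A n.+1 * A n.+2 * A n.+3 - somos_coef n.+1 * A n.+2 ^+ 3.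
  have e := congr1 (fun x : int => x%:~R : F) (somos_int_cubic s_init s_rec n).
  move: e; rewrite /A /somos_coef; case: odd => /= e;
    apply: etrans (etrans _ e) _; ring.
have A_eq0 n : (A n == 0) = (p %| numq (somos5 n))%Z.
  by rewrite -(dvdz_pcharf pF).
have A_window n i : (0 < i < 5)%N -> A n = 0 -> A (i + n)%N != 0.
  move=> i5 /eqP; rewrite !A_eq0 => pn; apply/negP => pin.
  have cop : coprimez (numq (somos5 n)) (numq (somos5 (i + n))).
    by apply: (somos_coprime s_init s_rec); lia.
  have : (p %| gcdz (numq (somos5 n)) (numq (somos5 (i + n))))%Z.
    by rewrite dvdz_gcd pn.
  rewrite (eqP cop) dvdz1 /= => /eqP p1; by move: (pcharf_prime pF); rewrite p1.
have TP k : iter k (addp E P) None = T <-> A k.+2 = 0.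
  apply: iff_trans (iter_addP_None n2 n3 k) _.
  exact: (iter_addP_T_None n2 n3 A_init A_rec A_inv A_window).
have dvdA m : int_dvd p (somos5 m) <-> A m = 0.
  rewrite (rwP eqP) A_eq0; have es := somos_int s_init s_rec m.
  split=> [[k ek]|/dvdzP[k ek]]; last by exists k; rewrite es ek.
  by move: ek; rewrite [LHS]es => /intr_inj ->; rewrite dvdz_mull.
have divisible : (exists m, int_dvd p (somos5 m)) <->
                 (exists k, iter k (addp E P) None = T).
  split=> [[m /dvdA]|[k /TP /dvdA ?]]; last by exists k.+2.
  (* The index shift by 2 misses only a_0 = a_1 = 1, which p does not divide. *)
  case: m => [|[|k /TP ?]]; last by exists k.
    by rewrite A_init // => /eqP; rewrite oner_eq0.
  by rewrite A_init // => /eqP; rewrite oner_eq0.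
have onP : on_curve E P by apply/eqP => /=; ring.
have onO k : on_curve E (iter k (addp E P) None) by apply: on_iter.
have exn : exists n, (0 < n)%N && (isog (iter n (addp E P) None) == None).
  pose f : option (F * F) -> option (F * F) := addp E P.
  (* Translation by P is injective on the finitely many points of E, so the orbit of O returns to O.
     Injectivity is known only on the curve, hence the relative form of [iter_order]. *)
  exists (order f None); rewrite order_gt0.
  have fK : iter (order f None) f None = None.
    apply: (@iter_order_in _ f (on_curve E)) => //.
      by move=> Q hQ; apply: on_curve_addp.
    exact: addP_inj.
  by apply/eqP; rewrite -/f fK.
case: (ex_minnP exn) => n /andP[n_gt0 /eqP en] n_min.
have early k : (0 < k < n)%N -> isog (iter k (addp E P) None) <> None.
  by move=> /andP[k0 kn] /eqP e; move: kn; rewrite ltnNge n_min // k0.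
have ordR : has_order E' R n.
  split=> // [|m /early]; rewrite /mulp -(isog_iter n2 n3) //.
have isog_O k := isog_eq_None (onO k).
have [eO|eT] := proj1 (isog_O n) en.
  have noT : ~ exists k, iter k (addp E P) None = T.
    move=> [k ek].
    (* Since nP = O, k may be reduced modulo n. The remainder is nonzero as T is not O, and it
       contradicts the minimality of n. *)
    have iterO q : iter (q * n) (addp E P) None = None.
      by elim: q => // q IH; rewrite mulSn iterD IH.
    have er : iter (k %% n) (addp E P) None = T.
      by rewrite -ek {2}(divn_eq k n) addnC iterD iterO.
    have [k0|k0] := posnP (k %% n)%N; first by rewrite k0 in er.
    apply: (early (k %% n)%N); first by rewrite k0 ltn_mod.
    by apply/isog_O; right.
  split=> [/divisible //|_]; exists n; split=> //; split=> // m /early h e.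
  by apply: h; rewrite /mulp in e; rewrite e.
split=> [_|[]]; last by apply/divisible; exists n.
exists n; split=> //.
have TO : iter n (addp E P) T = None by apply/(iter_addP_None n2 n3).
split; first by rewrite muln_gt0.
  by rewrite /mulp mul2n -addnn iterD eT TO.
move=> m m2n; rewrite /mulp => e.
have [mn|nm] := ltnP m n.
  by apply: (early m); [lia | rewrite e].
(* From mP = O and nP = T follows T + (m - n)P = O, so (m - n)P = T with m - n < n. Minimality of n
   excludes this, and m = n would give T = O. *)
have eT' : iter (m - n) (addp E P) None = T.
  apply/(iter_addP_None n2 n3).
  by rewrite -eT -iterD subnK.
have [k0|k0] := posnP (m - n)%N; first by rewrite k0 in eT'.
apply: (early (m - n)%N); first lia.
by apply/isog_O; right.
Qed.

(* Specialization to the reductions modulo p *)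
Local Close Scope ring_scope.

Theorem theorem3p2 (p : nat) (p_prime : prime p)
    (p_good : p \notin [:: 2; 3; 17]) :
  ((exists m : nat, int_dvd p (somos5 m)) ->
     exists n : nat,
       has_order (reduce_curve p curveE') (reduce_point p pointR) n /\
       has_order (reduce_curve p curveE) (reduce_point p pointP) (2 * n)) /\
  (~ (exists m : nat, int_dvd p (somos5 m)) ->
     exists n : nat,
       has_order (reduce_curve p curveE') (reduce_point p pointR) n /\
       has_order (reduce_curve p curveE) (reduce_point p pointP) n).
Proof.
have pF : p \in [pchar 'F_p]%R by apply: pchar_Fp.
have [n2 n3] : (2 != 0 :> 'F_p)%R /\ (3 != 0 :> 'F_p)%R.
  rewrite -!(dvdn_pcharf pF) !dvdn_prime2 //.
  by move: p_good; rewrite !inE !negb_or => /and3P[].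
rewrite reduce_curveE reduce_curveE' reduce_pointP // reduce_pointR //.
exact: (order_dichotomy pF n2 n3).
Qed.
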